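(* For $j=1,2$ let $\mathcal H_j$ be any complex Hilbert space, $(\Sigma_j,\mathcal M_j,\mu_j)$ any measure space, and let $\pi_j:\Sigma_j\to\mathbb B(\mathcal H_j)$ be a weakly measurable map. Assume that $p:\Sigma_2\to\Sigma_1$ is a measurable map satisfying $p_*(\mu_2)=\mu_1$ and $\iota:\mathcal H_1\to\mathcal H_2$ is a linear isometry for which $\pi_1\circ p=\iota^*\pi_2(\cdot)\iota$ almost everywhere on $\Sigma_2$. If $\pi_2\in\mathrm{SQ}(\mathbb B(\mathcal H_2),\mu_2)$, then also $\pi_1\in\mathrm{SQ}(\mathbb B(\mathcal H_1),\mu_1)$, and the diagram formed by the maps $$\Phi^{\pi_j}:\mathcal H_j\widehat\otimes\overline{\mathcal H}_j\to L^2(\Sigma_j,\mu_j)\ (j=1,2),\quad \iota\otimes\iota:\mathcal H_1\widehat\otimes\overline{\mathcal H}_1\to\mathcal H_2\widehat\otimes\overline{\mathcal H}_2,\quad L^2(\Sigma_1,\mu_1)\to L^2(\Sigma_2,\mu_2),\ f\mapsto f\circ p,$$ is commutative and all these maps are isometries; that is, $\Phi^{\pi_1}(x)\circ p=\Phi^{\pi_2}((\iota\otimes\iota)x)$ for all $x\in\mathcal H_1\widehat\otimes\overline{\mathcal H}_1$.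
   Context: Inner products are linear in the first variable and antilinear in the second. $\overline{\mathcal H}$ is the conjugate Hilbert space of $\mathcal H$ and $\widehat\otimes$ the Hilbert space tensor product. For a complex Hilbert space $\mathcal H$ and a measure space $(\Sigma,\mathcal M,\mu)$ ($\mu$ a positive measure), $\mathrm{SQ}(\mathbb B(\mathcal H),\mu)$ denotes the set of all almost everywhere defined, weakly measurable maps $\pi:\Sigma\to\mathbb B(\mathcal H)$ (i.e. $s\mapsto\langle\pi(s)u,v\rangle$ is measurable for all $u,v\in\mathcal H$) such that $$\int_\Sigma\langle\pi(s)u_1,v_1\rangle\langle v_2,\pi(s)u_2\rangle\,d\mu(s)=\langle u_1,u_2\rangle\langle v_2,v_1\rangle\quad\text{for all }u_1,u_2,v_1,v_2\in\mathcal H.$$ For $\pi\in\mathrm{SQ}(\mathbb B(\mathcal H),\mu)$, $\Phi^\pi:\mathcal H\widehat\otimes\overline{\mathcal H}\to L^2(\Sigma,\mu)$ is the unique linear isometry with $\Phi^\pi(u\otimes v)=\langle\pi(\cdot)u,v\rangle$ for $u,v\in\mathcal H$. *)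

(* Defs.v *)
From HB Require Import structures.
From mathcomp Require Import all_boot all_order all_algebra complex.
From mathcomp Require Import all_classical all_reals all_analysis.
From mathcomp Require Import measurable_realfun.

Set Implicit Arguments.
Unset Strict Implicit.
Unset Printing Implicit Defensive.

Import Order.TTheory GRing.Theory Num.Theory.
Import ComplexField.Normc.

Local Open Scope classical_set_scope.
Local Open Scope ring_scope.

(* A {dot H for conj} form is linear in its first and antilinear in its second
   argument. Norms on normed modules over R[i] take their values in R[i]. *)
HB.mixin Record isHilbert (R : realType) H of CompleteNormedModule R[i] H := {
  inner : {dot H for @Num.conj R[i]};
  inner_normE : forall u : H, inner u u = `|u| ^+ 2
}.

#[short(type="hilbertType")]
HB.structure Definition Hilbert (R : realType) :=
  {H of CompleteNormedModule R[i] H & isHilbert R H}.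

(* Same additive group and norm as H, with the scalar action (a, u) |-> a^* u
   and the inner product (u, v) |-> <v, u>. *)
Definition conj_space (R : realType) (H : hilbertType R) : Type := H.

Section conj_space.
Variables (R : realType) (H : hilbertType R).
Local Notation cH := (conj_space H).

HB.instance Definition _ := PseudoMetricNormedZmod.copy cH H.
HB.instance Definition _ := Complete.copy cH H.

Definition conj_scale (a : R[i]) (u : cH) : cH := Num.conj a *: (u : H).

Fact conj_scaleA a b u : conj_scale a (conj_scale b u) = conj_scale (a * b) u.
Proof. by rewrite /conj_scale scalerA -rmorphM. Qed.

Fact conj_scale1 : left_id 1 conj_scale.
Proof. by move=> u; rewrite /conj_scale rmorph1 scale1r. Qed.

Fact conj_scaleDr : right_distributive conj_scale +%R.
Proof. by move=> a u v; rewrite /conj_scale scalerDr. Qed.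

Fact conj_scaleDl u : {morph conj_scale^~ u : a b / a + b}.
Proof. by move=> a b; rewrite /conj_scale rmorphD scalerDl. Qed.

HB.instance Definition _ := GRing.Zmodule_isLmodule.Build R[i] cH
  conj_scaleA conj_scale1 conj_scaleDr conj_scaleDl.

Lemma conj_scaleE (a : R[i]) (u : cH) : a *: u = (Num.conj a *: (u : H) : H).
Proof. by []. Qed.

Fact conj_normrZ (a : R[i]) (u : cH) : `|a *: u| = `|a| * `|u|.
Proof. by rewrite conj_scaleE (@normrZ _ H) norm_conjC. Qed.

HB.instance Definition _ :=
  PseudoMetricNormedZmod_Lmodule_isNormedModule.Build R[i] cH conj_normrZ.

Definition conj_inner (u v : cH) : R[i] := inner (v : H) (u : H).

Fact conj_inner_bilinear : bilinear_for
  (GRing.Scale.Law.clone _ _ *%R _)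
  (GRing.Scale.Law.clone _ _ (@Num.conj R[i] \; *%R) _) conj_inner.
Proof.
split=> [v|u] a x y; rewrite /conj_inner conj_scaleE.
  by rewrite linearPr /= conjCK.
by rewrite linearPl.
Qed.

HB.instance Definition _ := bilinear_isBilinear.Build R[i] cH cH R[i] _ _
  conj_inner conj_inner_bilinear.

Fact conj_inner_herm (u v : cH) :
  conj_inner u v = (-1) ^+ false * Num.conj (conj_inner v u).
Proof. exact: (@hermitian_subproof _ _ _ _ inner). Qed.

HB.instance Definition _ := isHermitianSesquilinear.Build R[i] cH false
  (@Num.conj R[i]) conj_inner conj_inner_herm.

Fact conj_inner_gt0 (u : cH) : u != 0 -> 0 < conj_inner u u.
Proof. exact: (@neq0_dnorm_gt0 _ _ _ inner). Qed.

HB.instance Definition _ := isDotProduct.Build R[i] cH conj_inner conj_inner_gt0.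

Fact conj_inner_normE (u : cH) : conj_inner u u = `|u| ^+ 2.
Proof. exact: (@inner_normE R H). Qed.

HB.instance Definition _ := isHilbert.Build R cH conj_inner_normE.

End conj_space.

(* Borel measurability for R[i] identified with R x R; R[i] carries no
   canonical sigma-algebra in the library. *)
Definition cmeasurable_fun d (S : measurableType d) (R : realType)
    (D : set S) (f : S -> R[i]) :=
  measurable_fun D (fun s => complex.Re (f s)) /\
  measurable_fun D (fun s => complex.Im (f s)).

Section L2fun.
Context d (S : measurableType d) (R : realType) (mu : {measure set S -> \bar R}).
Implicit Types f g : S -> R[i].

Definition sq_integrable f :=
  cmeasurable_fun setT f /\ finite_norm mu 2%:E (fun s => normc (f s)).

Definition norm2 f : R := fine ('N[mu]_2%:E[EFin \o (fun s => normc (f s))])%E.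

Lemma normc_ge0 (z : R[i]) : 0 <= normc z.
Proof. by case: z => x y; exact: sqrtr_ge0. Qed.

Lemma cmeasurable_normc f : cmeasurable_fun setT f ->
  measurable_fun setT (fun s => normc (f s)).
Proof.
move=> [mr mi].
rewrite (_ : (fun _ => _) =
   (fun s => (complex.Re (f s) ^+ 2 + complex.Im (f s) ^+ 2) `^ (2^-1))).
  apply: (@measurableT_comp _ _ _ _ _ _ (@powR R ^~ 2^-1)) => //.
  by apply: measurable_funD; exact: measurable_funX.
apply/funext => s; case: (f s) => a b /=.
by rewrite powR12_sqrt // addr_ge0 ?sqr_ge0.
Qed.

Lemma le_norm2 (f g : S -> R) :
  measurable_fun setT f -> measurable_fun setT g ->
  (forall s, 0 <= f s <= g s) ->
  ('N[mu]_2%:E[EFin \o f] <= 'N[mu]_2%:E[EFin \o g])%E.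
Proof.
move=> mf mg fg; rewrite unlock gt0_ler_poweR//.
- by rewrite in_itv/= leey integral_ge0.
- by rewrite in_itv/= leey integral_ge0.
have mp (h : S -> R) : measurable_fun setT h ->
    measurable_fun setT (fun x => ((`|(EFin \o h) x| `^ 2)%E)).
  move=> mh; apply/measurable_EFinP.
  apply: (@measurableT_comp _ _ _ _ _ _ (@powR R ^~ 2)) => //.
  exact: measurableT_comp.
apply: ge0_le_integral => //.
- by move=> s _; exact: poweR_ge0.
- exact: mp.
- exact: mp.
move=> s _ /=; rewrite lee_fin ge0_ler_powR ?nnegrE//.
by have /andP[f0 fgs] := fg s; rewrite !ger0_norm// (le_trans f0).
Qed.

Lemma Lnorm2Z (a : R[i]) f : sq_integrable f ->
  ('N[mu]_2%:E[EFin \o (fun s => normc (a * f s))%R] =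
   (normc a)%:E * 'N[mu]_2%:E[EFin \o (fun s => normc (f s))])%E.
Proof.
move=> [mf nf]; have mnf := cmeasurable_normc mf.
pose nF : S -> R := fun s => normc (f s).
have Lf : nF \in Lfun mu 2%:E by apply/andP; rewrite !inE.
have p1 : (1 <= 2%:E :> \bar R)%E by rewrite lee_fin ler1n.
have := LnormZ (Lfun_Sub p1 Lf) (normc a).
rewrite Lfun_valP ger0_norm ?normc_ge0// => <-.
by apply: eq_Lnorm => s /=; rewrite normcM.
Qed.

Lemma cmeasurable_funD f g : cmeasurable_fun setT f ->
  cmeasurable_fun setT g -> cmeasurable_fun setT (fun s => f s + g s).
Proof.
move=> [fr fi] [gr gi]; split.
- rewrite (_ : (fun _ => _) =
    (fun s => complex.Re (f s) + complex.Re (g s))); first exact: measurable_funD.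
  by apply/funext => s; case: (f s) (g s) => [? ?] [? ?].
- rewrite (_ : (fun _ => _) =
    (fun s => complex.Im (f s) + complex.Im (g s))); first exact: measurable_funD.
  by apply/funext => s; case: (f s) (g s) => [? ?] [? ?].
Qed.

Lemma cmeasurable_funZ (a : R[i]) f :
  cmeasurable_fun setT f -> cmeasurable_fun setT (fun s => a * f s).
Proof.
move=> [mr mi]; split.
- rewrite (_ : (fun _ => _) = (fun s =>
    complex.Re a * complex.Re (f s) - complex.Im a * complex.Im (f s))).
    by apply: measurable_funB; apply: measurable_funM.
  by apply/funext => s; case: (a) (f s) => [x y] [z t].
- rewrite (_ : (fun _ => _) = (fun s =>
    complex.Re a * complex.Im (f s) + complex.Im a * complex.Re (f s))).
    by apply: measurable_funD; apply: measurable_funM.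
  by apply/funext => s; case: (a) (f s) => [x y] [z t].
Qed.

Lemma Lnorm2D f g : cmeasurable_fun setT f -> cmeasurable_fun setT g ->
  ('N[mu]_2%:E[EFin \o (fun s => normc (f s + g s)%R)] <=
   'N[mu]_2%:E[EFin \o (fun s => normc (f s))] +
   'N[mu]_2%:E[EFin \o (fun s => normc (g s))])%E.
Proof.
move=> mf mg.
have mnf := cmeasurable_normc mf; have mng := cmeasurable_normc mg.
apply: le_trans; last by apply: minkowski_EFin => //; rewrite ler1n.
apply: le_norm2; last first.
- by move=> s; rewrite normc_ge0 le_normcD.
- exact: measurable_funD.
exact/cmeasurable_normc/cmeasurable_funD.
Qed.

Definition L2fun_pred : {pred S -> R[i]} := mem [set f | sq_integrable f].

Fact L2fun_submod_closed : submod_closed L2fun_pred.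
Proof.
split.
  rewrite inE /=; split; first by split; exact: measurable_cst.
  rewrite /finite_norm (_ : EFin \o _ = cst 0%E) ?Lnorm0//.
  by apply/funext => s /=; rewrite expr0n addr0 sqrtr0.
move=> a f g /[!inE]/= sf sg.
have mZ := cmeasurable_funZ a sf.1.
split; first exact: (cmeasurable_funD mZ sg.1).
apply: le_lt_trans; first exact: (Lnorm2D mZ sg.1).
rewrite Lnorm2Z//; apply: lte_add_pinfty; last exact: sg.2.
by apply: lte_mul_pinfty; rewrite ?lee_fin ?normc_ge0//; exact: sf.2.
Qed.

HB.instance Definition _ :=
  GRing.isSubmodClosed.Build R[i] (S -> R[i]) L2fun_pred L2fun_submod_closed.

Record L2fun := L2Fun {
  L2fun_val :> S -> R[i];
  L2fun_valP : L2fun_val \in L2fun_pred }.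

HB.instance Definition _ := [isSub for L2fun_val].
HB.instance Definition _ := [Choice of L2fun by <:].
HB.instance Definition _ := [SubChoice_isSubLmodule of L2fun by <:].

Lemma L2funP (f : L2fun) : sq_integrable f.
Proof. by have := L2fun_valP f; rewrite inE. Qed.

Lemma norm2E (f : L2fun) :
  (norm2 f)%:E = ('N[mu]_2%:E[EFin \o (fun s => normc (f s))])%E.
Proof.
rewrite /norm2 fineK// ge0_fin_numE ?Lnorm_ge0//; exact: (L2funP f).2.
Qed.

Definition L2eq (f g : L2fun) := `[< {ae mu, forall s, f s = g s} >].

Fact L2eq_equiv : equiv_class_of L2eq.
Proof.
split.
- by move=> f; apply/asboolP; apply: aeW.
- by move=> f g; apply/asboolP/asboolP; apply: filterS => s ->.
- move=> g f h /asboolP fg /asboolP gh; apply/asboolP.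
  by move: fg gh; apply: filterS2 => s -> ->.
Qed.

Canonical L2eq_equivRel := EquivRelPack L2eq_equiv.

Local Open Scope quotient_scope.

(* Complex-valued square integrable functions modulo equality mu-a.e. *)
Definition L2 : Type := {eq_quot L2eq}.
HB.instance Definition _ := Choice.on L2.
HB.instance Definition _ := EqQuotient.on L2.

Definition L2_fun (x : L2) : S -> R[i] := repr x.

Definition L2_class (f : L2fun) : L2 := \pi f.

Lemma L2_classP (f g : L2fun) :
  L2_class f = L2_class g <-> {ae mu, forall s, f s = g s}.
Proof. by split => [/eqmodP/asboolP|fg]; last exact/eqmodP/asboolP. Qed.

Lemma L2_classK (f : L2fun) : {ae mu, forall s, L2_fun (L2_class f) s = f s}.
Proof. by apply/L2_classP; rewrite /L2_class reprK. Qed.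

Lemma L2_funK (x : L2) : L2_class (repr x) = x.
Proof. exact: reprK. Qed.

Definition L2_zero : L2 := L2_class 0.
Definition L2_opp (x : L2) : L2 := L2_class (- repr x).
Definition L2_add (x y : L2) : L2 := L2_class (repr x + repr y).
Definition L2_scale (a : R[i]) (x : L2) : L2 := L2_class (a *: repr x).

Lemma L2_addE (f g : L2fun) : L2_add (L2_class f) (L2_class g) = L2_class (f + g).
Proof.
apply/L2_classP; move: (L2_classK f) (L2_classK g).
apply: filterS2 => s fs gs.
by rewrite -[RHS]/(f s + g s) -[in RHS]fs -[in RHS]gs.
Qed.

Lemma L2_oppE (f : L2fun) : L2_opp (L2_class f) = L2_class (- f).
Proof.
apply/L2_classP; move: (L2_classK f).
by apply: filterS => s fs; rewrite -[RHS]/(- f s) -[in RHS]fs.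
Qed.

Lemma L2_scaleE (a : R[i]) (f : L2fun) : L2_scale a (L2_class f) = L2_class (a *: f).
Proof.
apply/L2_classP; move: (L2_classK f).
by apply: filterS => s fs; rewrite -[RHS]/(a * f s) -[in RHS]fs.
Qed.

Fact L2_addA : associative L2_add.
Proof.
move=> x y z; rewrite -(L2_funK x) -(L2_funK y) -(L2_funK z).
by rewrite !L2_addE addrA.
Qed.

Fact L2_addC : commutative L2_add.
Proof. by move=> x y; rewrite /L2_add addrC. Qed.

Fact L2_add0 : left_id L2_zero L2_add.
Proof. by move=> x; rewrite -(L2_funK x) L2_addE add0r. Qed.

Fact L2_addN : left_inverse L2_zero L2_opp L2_add.
Proof. by move=> x; rewrite -(L2_funK x) L2_oppE L2_addE addNr. Qed.

HB.instance Definition _ :=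
  GRing.isZmodule.Build L2 L2_addA L2_addC L2_add0 L2_addN.

Fact L2_scaleA a b x : L2_scale a (L2_scale b x) = L2_scale (a * b) x.
Proof. by rewrite -(L2_funK x) !L2_scaleE scalerA. Qed.

Fact L2_scale1 : left_id 1 L2_scale.
Proof. by move=> x; rewrite -(L2_funK x) L2_scaleE scale1r. Qed.

Fact L2_scaleDr : right_distributive L2_scale +%R.
Proof.
move=> a x y; rewrite -(L2_funK x) -(L2_funK y).
by rewrite [_ + _]L2_addE !L2_scaleE scalerDr [RHS]L2_addE.
Qed.

Fact L2_scaleDl x : {morph L2_scale^~ x : a b / a + b}.
Proof.
by move=> a b; rewrite -(L2_funK x) !L2_scaleE scalerDl [RHS]L2_addE.
Qed.

HB.instance Definition _ := GRing.Zmodule_isLmodule.Build R[i] L2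
  L2_scaleA L2_scale1 L2_scaleDr L2_scaleDl.

Definition L2_norm (x : L2) : R[i] := (norm2 (L2_fun x))%:C%C.

Lemma norm2_ae (f g : L2fun) : {ae mu, forall s, f s = g s} ->
  norm2 f = norm2 g.
Proof.
move=> fg; apply: EFin_inj; rewrite !norm2E unlock; congr (_ `^ _)%E.
have mp (h : L2fun) : measurable_fun setT
    (fun x => ((`|(EFin \o (fun s => normc (h s))) x| `^ 2)%E)).
  apply/measurable_EFinP.
  apply: (@measurableT_comp _ _ _ _ _ _ (@powR R ^~ 2)) => //.
  apply: measurableT_comp => //; apply: cmeasurable_normc; exact: (L2funP h).1.
apply: ae_eq_integral => //.
by apply: filterS fg => s /= ->.
Qed.

Lemma L2_normE (f : L2fun) : L2_norm (L2_class f) = (norm2 f)%:C%C.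
Proof. by rewrite /L2_norm (norm2_ae (L2_classK f)). Qed.

Fact L2_normD x y : L2_norm (x + y) <= L2_norm x + L2_norm y.
Proof.
rewrite -(L2_funK x) -(L2_funK y) [X in L2_norm X]L2_addE !L2_normE.
rewrite -rmorphD lecR -lee_fin EFinD !norm2E.
by apply: Lnorm2D; exact: (L2funP _).1.
Qed.

Fact L2_normZ (a : R[i]) x : L2_norm (a *: x) = `|a| * L2_norm x.
Proof.
rewrite -(L2_funK x) [X in L2_norm X]L2_scaleE !L2_normE.
have -> : `|a| = (normc a)%:C%C by case: (a).
rewrite -rmorphM; congr (_ %:C)%C; apply: EFin_inj.
by rewrite EFinM !norm2E -Lnorm2Z//; exact: L2funP.
Qed.

Fact L2_norm0_eq0 x : L2_norm x = 0 -> x = 0.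
Proof.
rewrite -(L2_funK x) L2_normE => -[] n0; apply/L2_classP.
have mf := cmeasurable_normc (L2funP (repr x)).1.
have := norm2E (repr x); rewrite n0 => /esym/Lnorm_eq0_eq0.
move=> /(_ ((measurable_EFinP _ _).2 mf)).
rewrite lte_fin ltr0n => /(_ isT).
by apply: filterS => s /(_ I) /= [] /eq0_normc.
Qed.

HB.instance Definition _ :=
  Lmodule_isNormed.Build R[i] L2 L2_normD L2_normZ L2_norm0_eq0.

End L2fun.

Arguments L2 {d S R} mu.
Coercion L2_fun : L2 >-> Funclass.

Lemma L2_ext d (S : measurableType d) (R : realType)
    (mu : {measure set S -> \bar R}) (x y : L2 mu) :
  {ae mu, forall s, x s = y s} -> x = y.
Proof. by move=> /L2_classP; rewrite !L2_funK. Qed.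

Section L2_comp.
Context d1 d2 (S1 : measurableType d1) (S2 : measurableType d2) (R : realType).
Variables (mu1 : {measure set S1 -> \bar R}) (mu2 : {measure set S2 -> \bar R}).
Variable p : {mfun S2 >-> S1}.
Hypothesis p_mu2 : forall A, measurable A -> pushforward mu2 p A = mu1 A.

Fact ae_comp (P : set S1) :
  {ae mu1, forall s, P s} -> {ae mu2, forall s, P (p s)}.
Proof.
move=> [N [mN N0 PN]]; exists (p @^-1` N); split.
- by rewrite -[X in measurable X]setTI; exact: measurable_funPT.
- by rewrite -[LHS]/(pushforward mu2 p N) p_mu2.
- by move=> s /PN.
Qed.

Fact Lnorm2_comp (h : S1 -> R) : measurable_fun setT h ->
  ('N[mu2]_2%:E[EFin \o (h \o p)] = 'N[mu1]_2%:E[EFin \o h])%E.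
Proof.
move=> mh; rewrite unlock; congr (_ `^ _)%E.
have mF : measurable_fun setT (fun x => ((`|(EFin \o h) x| `^ 2)%E)).
  apply/measurable_EFinP.
  apply: (@measurableT_comp _ _ _ _ _ _ (@powR R ^~ 2)) => //.
  exact: measurableT_comp.
rewrite [RHS](eq_measure_integral (pushforward mu2 p)); last first.
  by move=> A mA _; rewrite -p_mu2.
by rewrite [RHS]ge0_integral_pushforward// => s _; exact: poweR_ge0.
Qed.

Fact L2fun_comp_subproof (f : L2fun mu1) : (f \o p) \in L2fun_pred mu2.
Proof.
rewrite inE /=; have [[mr mi] nf] := L2funP f; split.
  split; first exact: (measurableT_comp mr).
  exact: (measurableT_comp mi).
rewrite /finite_norm.
by have -> := Lnorm2_comp (cmeasurable_normc (conj mr mi)).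
Qed.

Definition L2fun_comp (f : L2fun mu1) : L2fun mu2 :=
  L2Fun (L2fun_comp_subproof f).

(* f |-> f \o p; by L2_compE it does not depend on the representative. *)
Definition L2_comp (x : L2 mu1) : L2 mu2 := L2_class (L2fun_comp (repr x)).

Lemma L2_compE (f : L2fun mu1) : L2_comp (L2_class f) = L2_class (L2fun_comp f).
Proof. by apply/L2_classP; apply: ae_comp (L2_classK f). Qed.

End L2_comp.

Definition linear_isometry (R : realType) (V W : normedModType R[i])
    (f : V -> W) :=
  linear f /\ forall x, `|f x| = `|x|.

Record bounded_op (R : realType) (H : hilbertType R) := BoundedOp {
  bounded_op_linear :> {linear H -> H};
  bounded_op_continuous : continuous bounded_op_linear
}.

(* In the definitions by xget below, the *_unique lemmas state that the chosen
   value is the only witness of the defining property whenever there is one. *)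
Section adjoint.
Variables (R : realType) (H K : hilbertType R) (f : H -> K).

Definition is_adjoint (g : K -> H) : Prop :=
  forall u v, inner (f u) v = inner u (g v).

Definition adjoint : K -> H := xget (cst 0) is_adjoint.

Lemma adjoint_unique g : is_adjoint g -> adjoint = g.
Proof.
move=> gP; apply: xget_unique => // h hP; apply/funext => v.
apply/eqP; rewrite -subr_eq0 -normr_eq0 -sqrf_eq0 -inner_normE.
have -> : inner (h v - g v) (h v - g v) =
    inner (h v - g v) (h v) - inner (h v - g v) (g v) by exact: linearBr.
by rewrite -hP -gP subrr.
Qed.

End adjoint.

(* The Hilbert space tensor product, determined up to a unique unitary
   compatible with tens: a complete space in which the elementary tensors span
   a dense subspace. The set below is a linear subspace since scalars can be
   absorbed in the u i. *)
Record hilbert_tensor (R : realType) (H K : hilbertType R) := HilbertTensor {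
  tensor_space :> hilbertType R;
  tens : {bilinear H -> K -> tensor_space};
  inner_tens : forall (u1 u2 : H) (v1 v2 : K),
    inner (tens u1 v1) (tens u2 v2) = inner u1 u2 * inner v1 v2;
  tens_dense : dense
    [set x | exists n (u : 'I_n -> H) (v : 'I_n -> K),
               x = \sum_(i < n) tens (u i) (v i)]
}.
Arguments tens {R H K}.

Lemma tensor_ext (R : realType) (H K : hilbertType R) (T : hilbert_tensor H K)
    (W : normedModType R[i]) (F G : T -> W) :
  linear F -> linear G -> continuous F -> continuous G ->
  (forall u v, F (tens T u v) = G (tens T u v)) -> F = G.
Proof.
move=> lF lG cF cG FG; apply/funext => x; apply/eqP/negPn/negP => FGx.
have F0 (L : T -> W) : linear L -> L 0 = 0.
  by move=> lL; have /eqP := lL 1 0 0; rewrite !scale1r addr0 -subr_eq subrr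
    => /eqP.
pose O := [set y : T | F y - G y != 0].
have oO : open O.
  have cFG : continuous (fun y => F y - G y).
    by move=> y; apply: cvgB; [exact: cF | exact: cG].
  rewrite (_ : O = (fun y => F y - G y) @^-1` [set~ 0]).
    apply: open_comp; first by move=> y _; exact: cFG.
    exact/closed_openC/accessible_closed_set1/hausdorff_accessible/norm_hausdorff.
  by apply/seteqP; split=> y /= /eqP.
have [|y [/= Oy [n [u [v yE]]]]] := tens_dense _ oO.
  by exists x; rewrite /O /= subr_eq0.
move/negP: Oy; apply; rewrite subr_eq0 yE; apply/eqP.
elim/big_rec : _ => [|i z _ IH]; first by rewrite (F0 _ lF) (F0 _ lG).
have := lF 1 (tens T (u i) (v i)) z; have := lG 1 (tens T (u i) (v i)) z.
by rewrite !scale1r => -> ->; rewrite FG IH.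
Qed.

Lemma linear_isometry_continuous (R : realType) (V W : normedModType R[i])
    (f : V -> W) : linear_isometry f -> continuous f.
Proof.
move=> [lf nf] x; apply/cvgrPdist_lt => e e0; near=> y.
have <- : f (x - y) = f x - f y.
  by have := lf (-1) y x; rewrite !scaleN1r [x - y]addrC [f x - _]addrC.
by rewrite nf; near: y; exact: cvgr_dist_lt.
Unshelve. all: by end_near. Qed.

Section tensor_map.
Variables (R : realType) (H1 H2 K1 K2 : hilbertType R).
Variables (T1 : hilbert_tensor H1 K1) (T2 : hilbert_tensor H2 K2).
Variables (f : H1 -> H2) (g : K1 -> K2).

Definition is_tensor_map (F : T1 -> T2) : Prop :=
  [/\ linear F, continuous F &
      forall u v, F (tens T1 u v) = tens T2 (f u) (g v)].

Definition tensor_map : T1 -> T2 := xget (cst 0) is_tensor_map.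

Lemma tensor_map_unique F : is_tensor_map F -> tensor_map = F.
Proof.
move=> [lF cF FE]; apply: xget_unique => // G [lG cG GE].
by apply: tensor_ext => // u v; rewrite FE GE.
Qed.

End tensor_map.
Arguments tensor_map {R H1 H2 K1 K2} T1 T2 f g.

Section square_integrable_maps.
Context d (S : measurableType d) (R : realType) (mu : {measure set S -> \bar R}).

Definition cintegrable (f : S -> R[i]) :=
  mu.-integrable setT (EFin \o (fun s => complex.Re (f s))) /\
  mu.-integrable setT (EFin \o (fun s => complex.Im (f s))).

Definition cintegral (f : S -> R[i]) : R[i] :=
  Complex (\int[mu]_s complex.Re (f s)) (\int[mu]_s complex.Im (f s)).

(* A map to the bounded operators that is defined almost everywhere is
   represented by an option-valued map, equal to None off its domain. *)
Variable H : hilbertType R.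
Implicit Types pi : S -> option (bounded_op H).

Definition op_dom pi : set S := [set s | pi s].

Definition ae_defined pi := measurable (op_dom pi) /\ mu (~` op_dom pi) = 0.

Definition mcoef pi (u v : H) (s : S) : R[i] :=
  if pi s is Some A then inner (A u) v else 0.

Definition weakly_measurable pi :=
  forall u v, cmeasurable_fun (op_dom pi) (mcoef pi u v).

(* Integrability is part of the condition because Rintegral is a total
   function: it returns a junk value on non-integrable functions. *)
Definition SQ pi :=
  [/\ ae_defined pi, weakly_measurable pi &
    forall u1 u2 v1 v2 : H,
      let F s := if pi s is Some A
                 then inner (A u1) v1 * inner v2 (A u2) else 0 in
      cintegrable F /\ cintegral F = inner u1 u2 * inner v2 v1].

Variable T : hilbert_tensor H (conj_space H).

Definition is_Phi pi (F : T -> L2 mu) : Prop :=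
  linear_isometry F /\
  forall u v : H, {ae mu, forall s, F (tens T u v) s = mcoef pi u v s}.

Definition Phi pi : T -> L2 mu := xget (cst 0) (is_Phi pi).

Lemma Phi_unique pi F : is_Phi pi F -> Phi pi = F.
Proof.
move=> FP; apply: xget_unique => // G [iG GE].
have [iF FE] := FP; apply: tensor_ext; [exact: iG.1|exact: iF.1| | |].
- exact: linear_isometry_continuous.
- exact: linear_isometry_continuous.
move=> u v; apply: L2_ext; move: (GE u v) (FE u v).
by apply: filterS2 => s -> ->.
Qed.

End square_integrable_maps.

Arguments SQ {d S R} mu {H} pi.
Arguments Phi {d S R} mu {H} T pi.

(* Main.v *)
Require Import Defs.
From HB Require Import structures.
From mathcomp Require Import all_boot all_order all_algebra complex.
From mathcomp Require Import all_classical all_reals all_analysis.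
From mathcomp Require Import measurable_realfun.
From mathcomp Require Import ring lra.

Set Implicit Arguments.
Unset Strict Implicit.
Unset Printing Implicit Defensive.

Import Order.TTheory GRing.Theory Num.Theory.
Import numFieldNormedType.Exports.
Local Open Scope classical_set_scope.
Local Open Scope ring_scope.

(** The matrix coefficients of pi1, composed with p, are matrix coefficients of
    pi2: almost everywhere on S2,
      < pi1 (p s) u, v > = < iota^* pi2(s) iota u, v >
                         = < pi2(s) iota u, iota v >.
    Since p transports mu2 to mu1, the orthogonality relations of pi1 are then
    those of pi2 at the vectors iota u and iota v, and iota preserves inner
    products.  On elementary tensors the two paths around the square give the
    two sides of this identity; all maps involved are linear isometries, hence
    continuous, so the paths agree everywhere by density.

    The substance lies in the existence of the objects named in the statement.

    The adjoint of an isometry f (isometry_adjoint).  For each w the distance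
    from f u to w has a minimiser g: by the parallelogram law a minimising
    sequence is Cauchy.  By minimality f g - w is orthogonal to the range of f,
    which says that g is the value of the adjoint at w.

    The maps on Hilbert tensor products (tensor_extension).  A prescription c
    on elementary tensors extends to a linear isometry into a complete space as
    soon as every finite linear combination of values of c has the norm of the
    corresponding combination of tensors.  The extension is the closure of the
    graph on finite combinations (isometric_extension).  It yields the map
    iota (x) iota, because iota preserves inner products, and Phi, because the
    orthogonality relations of a square integrable map say that its coefficient
    functions have the Gram matrix of the elementary tensors.

    Completeness of L2 (L2_fast_complete), needed for Phi.  This is the theorem
    of Riesz and Fischer: if the steps of a sequence have summable norms, then
    by Minkowski and monotone convergence the sum of their moduli is square
    integrable, so the sequence converges almost everywhere, and the tails of
    this sum bound the distance to the limit. *)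

(** * Isometries defined on a dense subspace *)

(** Completeness tested on the sequences whose steps are bounded by a fixed
    geometric series, with an explicit rate of convergence.  Asking for these
    sequences alone spares extracting subsequences in the proof for L2. *)
Definition fast_complete (R : realType) (W : normedModType R[i]) :=
  forall y : nat -> W, (forall n, `|y n.+1 - y n| <= 2^-1 ^+ n) ->
  exists l, forall n, `|l - y n| <= 2 * 2^-1 ^+ n.

Lemma half_powC (R : realType) n : ((2^-1 ^+ n)%:C)%C = 2^-1 ^+ n :> R[i].
Proof. by rewrite rmorphXn fmorphV rmorph_nat. Qed.

Lemma half_pow_small (R : realType) (e : R[i]) : 0 < e ->
  exists n, 2 * 2^-1 ^+ n <= e.
Proof.
move=> e0; have [r eE] : exists r, e = r%:C%C.
  exact/complex_realP/gtr0_real.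
move: e0; rewrite eE => /[!ltcR] r0.
have /cvgrPdist_le/(_ r) : (2 * 2^-1 ^+ n : R) @[n --> \oo] --> (0 : R).
  rewrite -[X in _ --> X](mulr0 2); apply: cvgMr.
  by apply: cvg_expr; rewrite ger0_norm// invf_lt1// ltr1n.
move=> /(_ r0) [n _ /(_ n (leqnn n))]; rewrite sub0r normrN => nr; exists n.
rewrite -[2 * _ ^+ n](_ : (2 * 2^-1 ^+ n)%:C%C = _).
  by rewrite lecR; apply: le_trans nr; exact: ler_norm.
by rewrite rmorphM /= half_powC rmorph_nat.
Qed.

Lemma telescope_half (R : realType) (W : normedModType R[i]) (y : nat -> W) :
  (forall n, `|y n.+1 - y n| <= 2^-1 ^+ n) ->
  forall n k, `|y (n + k)%N - y n| <= 2 * 2^-1 ^+ n - 2 * 2^-1 ^+ (n + k).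
Proof.
move=> hy n; elim=> [|k IH]; first by rewrite addn0 !subrr normr0.
rewrite addnS -[y (n + k).+1](subrK (y (n + k)%N)) -addrA.
apply: (le_trans (ler_normD _ _)); apply: (le_trans (lerD (hy _) IH)).
rewrite exprS mulrA divff ?mul1r ?pnatr_eq0//.
by rewrite addrCA lerD2l mulr_natl mulr2n opprD addrA subrr add0r.
Qed.

Lemma complete_fast_complete (R : realType) (W : completeNormedModType R[i]) :
  fast_complete W.
Proof.
move=> y hy.
have dy n k : `|y (n + k)%N - y n| <= 2 * 2^-1 ^+ n.
  apply: (le_trans (telescope_half hy n k)).
  by rewrite gerBl mulr_ge0// exprn_ge0// invr_ge0.
have cy : cvg (y @ \oo).
  apply/cauchy_cvgP/cauchy_ballP => e e0.
  have [N hN] := half_pow_small (divr_gt0 e0 (ltr0Sn _ 2)).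
  exists ([set y n | n in [set n | (N <= n)%N]],
          [set y n | n in [set n | (N <= n)%N]]).
    by split=> /=; exists N => // n /= Nn; exists n.
  move=> [_ _] /= [[n /= Nn <-] [m /= Nm <-]]; rewrite -ball_normE /=.
  have hn q : (N <= q)%N -> `|y q - y N| <= e / 3.
    by move=> Nq; apply: le_trans hN; rewrite -(subnKC Nq); exact: dy.
  rewrite (_ : y n - y m = (y n - y N) - (y m - y N)); last first.
    by rewrite opprB addrA subrK.
  apply: (le_lt_trans (ler_normB _ _)).
  apply: (le_lt_trans (lerD (hn _ Nn) (hn _ Nm))).
  rewrite [ltRHS](_ : e = e / 3 + e / 3 + e / 3); last by field.
  by rewrite ltrDl divr_gt0.
exists (lim (y @ \oo)) => n; apply/ler_addgt0Pr => e e0.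
have [N _ hN] := cvgr_dist_le _ _ cy e e0.
rewrite -(subrKA (y (n + N)%N)) (le_trans (ler_normD _ _))// addrC lerD//.
by apply: hN; rewrite /= leq_addl.
Qed.

(** The relation G is the graph of a norm preserving linear map whose domain is
    dense; the graph of its extension is the closure cl of G.  A relation is used
    because in the applications the domain consists of finite combinations of
    elementary tensors, which have many expressions: single-valuedness is not
    known beforehand but follows from preservation of norms. *)
Section isometric_extension.
Variables (R : realType) (V W : normedModType R[i]) (G : V -> W -> Prop).
Hypothesis fcW : fast_complete W.
Hypothesis G_linear : forall a x y x' y',
  G x y -> G x' y' -> G (a *: x + x') (a *: y + y').
Hypothesis G_norm : forall x y, G x y -> `|y| = `|x|.
Hypothesis G_dense : forall x e, 0 < e -> exists a b, G a b /\ `|x - a| <= e.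

Let cl x y := forall e : R[i], 0 < e ->
  exists a b, [/\ G a b, `|x - a| <= e & `|y - b| <= e].

Let cl_G x y : G x y -> cl x y.
Proof. by move=> Gxy e e0; exists x, y; split=> //; rewrite subrr normr0 ltW. Qed.

Let cl_linear a x y x' y' : cl x y -> cl x' y' -> cl (a *: x + x') (a *: y + y').
Proof.
move=> cxy cxy' e e0.
have a1 : 0 < `|a| + 1 by rewrite ltr_wpDl.
have d0 : 0 < e / (`|a| + 1) by rewrite divr_gt0.
have [u [v [Guv xu yv]]] := cxy _ d0.
have [u' [v' [Guv' xu' yv']]] := cxy' _ d0.
exists (a *: u + u'), (a *: v + v'); split; first exact: G_linear.
- rewrite opprD addrACA -scalerBr (le_trans (ler_normD _ _))// normrZ.
  rewrite -[leRHS](divfK (lt0r_neq0 a1)) mulrDr mulr1 lerD// mulrC.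
  by rewrite ler_wpM2r.
- rewrite opprD addrACA -scalerBr (le_trans (ler_normD _ _))// normrZ.
  rewrite -[leRHS](divfK (lt0r_neq0 a1)) mulrDr mulr1 lerD// mulrC.
  by rewrite ler_wpM2r.
Qed.

Let norm_near (V' : normedModType R[i]) (p q : V') (d : R[i]) :
  `|p - q| <= d -> `|p| <= `|q| + d.
Proof.
by move=> pqd; rewrite -{1}(subrK q p) addrC (le_trans (ler_normD _ _))// lerD2l.
Qed.

Let cl_norm x y : cl x y -> `|y| = `|x|.
Proof.
move=> cxy; apply/eqP; rewrite eq_le; apply/andP; split;
  apply/ler_addgt0Pr => e e0;
  have [a [b [Gab xa yb]]] := cxy _ (divr_gt0 e0 (ltr0Sn _ 1));
  rewrite (splitr e) addrA.
- rewrite (le_trans (norm_near yb))// (G_norm Gab) lerD2r norm_near// distrC//.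
- rewrite (le_trans (norm_near xa))// -(G_norm Gab) lerD2r norm_near// distrC//.
Qed.

Let cl_fun x y y' : cl x y -> cl x y' -> y = y'.
Proof.
move=> cxy cxy'; have := cl_norm (cl_linear (-1) cxy' cxy).
by rewrite !scaleN1r ![- _ + _]addrC subrr normr0 => /normr0_eq0/subr0_eq.
Qed.

Let cl_total x : exists y, cl x y.
Proof.
have d0 n : 0 < 2^-1 ^+ n / 2 :> R[i] by rewrite divr_gt0// exprn_gt0// invr_gt0.
have /choice[u /choice[v uv]] : forall n, exists a b,
    G a b /\ `|x - a| <= 2^-1 ^+ n / 2 by move=> n; exact: G_dense.
have Gsub n m : `|v n - v m| = `|u n - u m|.
  apply: G_norm; have := G_linear (-1) (uv m).1 (uv n).1.
  by rewrite !scaleN1r ![- _ + _]addrC.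
have [n|l hl] := fcW (y := v).
  rewrite Gsub -(subrKA x).
  apply: le_trans (ler_normD _ _) _.
  rewrite [leRHS]splitr lerD ?(uv n).2// (distrC (u _)) (le_trans (uv n.+1).2)//.
  rewrite ler_wpM2r// exprS ger_pMl ?exprn_gt0// ?invr_gt0//.
  by rewrite invf_le1// ler1n.
exists l => e e0; have [n hn] := half_pow_small e0.
exists (u n), (v n); split; [exact: (uv n).1| |exact: le_trans (hl n) hn].
apply: le_trans (uv n).2 (le_trans _ hn).
rewrite mulrC ler_wpM2r ?exprn_ge0//.
by rewrite (@le_trans _ _ 1)// ?ler1n// invf_le1// ler1n.
Qed.

Lemma isometric_extension :
  exists F : V -> W, linear_isometry F /\ forall x y, G x y -> F x = y.
Proof.
have [F clF] := choice cl_total; exists F; split; first split.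
- by move=> a x y; apply: cl_fun (clF _) _; exact: cl_linear.
- by move=> x; exact: cl_norm.
- by move=> x y /cl_G; exact: cl_fun.
Qed.

End isometric_extension.

(** * Inner products and tensor products *)

(** Restatements of the laws of sesquilinear forms in which both sides are
    written with inner, so that they chain as rewrite rules. *)
Section inner_theory.
Variables (R : realType) (H : hilbertType R).
Implicit Types u v w : H.

Lemma innerC u v : inner u v = (inner v u)^*%R.
Proof. by rewrite hermC expr0 mul1r. Qed.

Lemma innerZl a u v : inner (a *: u) v = a * inner u v.
Proof. exact: linearZl_LR. Qed.

Lemma innerZr a u v : inner u (a *: v) = a^* * inner u v.
Proof. exact: linearZr_LR. Qed.

Lemma innerDl u v w : inner (u + v) w = inner u w + inner v w.
Proof. exact: linearDl. Qed.

Lemma innerBl u v w : inner (u - v) w = inner u w - inner v w.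
Proof. exact: linearBl. Qed.

Lemma inner_suml I (r : seq I) (E : I -> H) v :
  inner (\sum_(i <- r) E i) v = \sum_(i <- r) inner (E i) v.
Proof. exact: linear_sumlz. Qed.

Lemma inner_sumr I (r : seq I) (E : I -> H) u :
  inner u (\sum_(i <- r) E i) = \sum_(i <- r) inner u (E i).
Proof. exact: linear_sumr. Qed.

End inner_theory.

Lemma inner_norm_eq (R : realType) (H K : hilbertType R) (u : H) (v : K) :
  inner u u = inner v v -> `|u| = `|v|.
Proof.
move=> uv; apply/eqP; rewrite -(@eqrXn2 _ 2)// -!inner_normE; exact/eqP.
Qed.

(** Polarization: expanding the norm of u + v gives the real part of
    inner u v, and that of 'i u + v gives its imaginary part. *)
Lemma isometry_inner (R : realType) (H K : hilbertType R) (f : H -> K) :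
  linear_isometry f -> forall u v, inner (f u) (f v) = inner u v.
Proof.
move=> [lf nf].
have fE a x y : f (a *: x + y) = a *: f x + f y by exact: lf.
have nE x : inner (f x) (f x) = inner x x by rewrite !inner_normE nf.
have reE x y : inner (f x) (f y) + (inner (f x) (f y))^* =
               inner x y + (inner x y)^*.
  have := nE (1 *: x + y); rewrite fE !scale1r !dnormD !nE.
  by move/addrI.
move=> u v.
have := reE u v; have := reE ('i *: u) v.
rewrite -[in f _](addr0 ('i *: u)) fE.
have f0 : f 0 = 0.
  by have := fE 1 0 0; rewrite !scale1r addr0 -[LHS]addr0 => /addrI.
rewrite f0 !addr0 !innerZl !rmorphM /= conjCi !mulNr -!mulrBr.
move=> /(mulfI (neq0Ci _)) dif sum; apply: (@mulfI _ 2); first by rewrite pnatr_eq0.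
have two (z : R[i]) : 2 * z = (z + z^*) + (z - z^*) by ring.
by rewrite two sum dif -two.
Qed.

Section tensor_extension.
Variables (R : realType) (H K : hilbertType R) (T : hilbert_tensor H K).
Variables (W : normedModType R[i]) (c : H -> K -> W).

Let span_T (s : seq (R[i] * (H * K))) := \sum_(z <- s) z.1 *: tens T z.2.1 z.2.2.
Let span_W (s : seq (R[i] * (H * K))) := \sum_(z <- s) z.1 *: c z.2.1 z.2.2.

Lemma inner_span_tensor (s t : seq (R[i] * (H * K))) :
  inner (\sum_(z <- s) z.1 *: tens T z.2.1 z.2.2)
        (\sum_(z <- t) z.1 *: tens T z.2.1 z.2.2) =
  \sum_(z <- s) \sum_(w <- t)
    z.1 * (w.1)^* * (inner z.2.1 w.2.1 * inner z.2.2 w.2.2).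
Proof.
rewrite inner_suml; apply: eq_bigr => z _; rewrite inner_sumr.
apply: eq_bigr => w _.
by rewrite innerZl innerZr inner_tens mulrA.
Qed.

(** Finite combinations of elementary tensors are dense, and the hypothesis says
    that sending tens u v to c u v preserves their norms; in particular it is
    compatible with all linear relations between elementary tensors. *)
Lemma tensor_extension : fast_complete W ->
  (forall s : seq (R[i] * (H * K)),
     `|\sum_(z <- s) z.1 *: c z.2.1 z.2.2| =
     `|\sum_(z <- s) z.1 *: tens T z.2.1 z.2.2|) ->
  exists F : T -> W, linear_isometry F /\ forall u v, F (tens T u v) = c u v.
Proof.
move=> fcW cN.
pose G x y := exists s, x = span_T s /\ y = span_W s.
have [| | | |F [iF FG]] := @isometric_extension R T W G.
- exact: fcW.
- move=> a _ _ _ _ [s [-> ->]] [t [-> ->]].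
  exists ([seq (a * z.1, z.2) | z <- s] ++ t).
  rewrite /span_T /span_W !big_cat !big_map /= !scaler_sumr.
  by split; congr (_ + _); apply: eq_bigr => z _; rewrite scalerA.
- by move=> _ _ [s [-> ->]]; exact: cN.
- move=> x e e0; have [||y [/= xy [n [u [v yE]]]]] := @tens_dense _ _ _ T (ball x e).
  + by exists x; exact: ballxx.
  + exact: ball_open.
  pose s := [seq (1 : R[i], (u i, v i)) | i <- index_enum 'I_n].
  exists y, (span_W s); split; last first.
    by apply: ltW; move: xy; rewrite -ball_normE.
  exists s; split=> //; rewrite yE /span_T big_map; apply: eq_bigr => i _ /=.
  by rewrite scale1r.
exists F; split=> // u v; apply: FG; exists [:: (1, (u, v))].
by rewrite /span_T /span_W !big_seq1 !scale1r.
Qed.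

End tensor_extension.

Lemma tensor_map_exists (R : realType) (H1 H2 K1 K2 : hilbertType R)
    (T1 : hilbert_tensor H1 K1) (T2 : hilbert_tensor H2 K2)
    (f : H1 -> H2) (g : K1 -> K2) :
  linear_isometry f -> linear_isometry g ->
  linear_isometry (tensor_map T1 T2 f g) /\
  forall u v, tensor_map T1 T2 f g (tens T1 u v) = tens T2 (f u) (g v).
Proof.
move=> If Ig.
have [|F [IF FE]] := @tensor_extension _ _ _ T1 _ (fun u v => tens T2 (f u) (g v))
  (@complete_fast_complete _ T2).
  move=> s; apply: inner_norm_eq; rewrite inner_span_tensor.
  have -> : \sum_(z <- s) z.1 *: tens T2 (f z.2.1) (g z.2.2) =
    \sum_(z <- [seq (z.1, (f z.2.1, g z.2.2)) | z <- s]) z.1 *: tens T2 z.2.1 z.2.2.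
    by rewrite big_map.
  rewrite inner_span_tensor big_map; apply: eq_bigr => z _; rewrite big_map /=.
  by apply: eq_bigr => w _; rewrite !isometry_inner.
have -> : tensor_map T1 T2 f g = F.
  apply: tensor_map_unique; split=> //; first exact: IF.1.
  exact: linear_isometry_continuous.
by [].
Qed.

Lemma conj_linear_isometry (R : realType) (H K : hilbertType R) (f : H -> K) :
  linear_isometry f ->
  linear_isometry (f : conj_space H -> conj_space K).
Proof. by move=> [lf nf]; split=> // a u v; rewrite conj_scaleE lf. Qed.

(** * The adjoint of an isometry *)

Section inner_inequalities.
Variables (R : realType) (K : hilbertType R).

(** If a nearly minimises the norm on the line a + t b, then a is nearly
    orthogonal to b: the minimum over t is |a|^2 - |<a, b>|^2 / |b|^2.  With
    d = 0 this is the Cauchy-Schwarz inequality. *)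
Lemma almost_orthogonal (a b : K) (d e : R[i]) :
  inner a a <= d + e -> (forall t, d <= inner (a + t *: b) (a + t *: b)) ->
  `|inner a b| ^+ 2 <= e * inner b b.
Proof.
move=> ade dle; have [->|b0] := eqVneq b 0.
  by rewrite !linear0r normr0 expr0n.
have bb : 0 < inner b b by rewrite dnorm_gt0.
set p := inner a b.
have bbr : (inner b b)^* = inner b b by rewrite -innerC.
have pp : p * p^* = `|p| ^+ 2 by rewrite normCK.
(* The minimising value of t. *)
have := dle (- p / inner b b); rewrite dnormD dnormZ innerZr -/p.
rewrite normrM normrN normfV (ger0_norm (ltW bb)) rmorphM rmorphN /= fmorphV /= bbr.
rewrite exprMn exprVn mulrAC.
have -> : `|p| ^+ 2 * inner b b / inner b b ^+ 2 = `|p| ^+ 2 / inner b b.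
  by rewrite expr2 invfM mulrA mulfK// gt_eqF.
have -> : - p^* / inner b b * p = - (`|p| ^+ 2 / inner b b).
  by rewrite !mulNr mulrAC [_ * p]mulrC pp.
have xr : (`|p| ^+ 2 / inner b b)^* = `|p| ^+ 2 / inner b b.
  by rewrite rmorphM /= fmorphV /= bbr rmorphXn /= conj_normC.
rewrite rmorphN /= xr -ler_pdivrMr//; set X := `|p| ^+ 2 / inner b b => dX.
rewrite addrA addrK in dX.
by rewrite -(lerD2l d); apply: le_trans ade; rewrite -lerBrDr.
Qed.

Lemma norm_inner_le (x y : K) : `|inner x y| <= `|x| * `|y|.
Proof.
rewrite -(@ler_pXn2r _ 2)// ?nnegrE ?mulr_ge0//.
rewrite exprMn -!inner_normE; apply: (almost_orthogonal (d := 0)).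
  by rewrite add0r.
by move=> t; exact: dnorm_ge0.
Qed.

Lemma parallelogram (x y : K) :
  `|x - y| ^+ 2 = 2 * `|x| ^+ 2 + 2 * `|y| ^+ 2 - 4 * `|2^-1 *: (x + y)| ^+ 2.
Proof.
have -> : 4 * `|2^-1 *: (x + y)| ^+ 2 = `|x + y| ^+ 2.
  by rewrite normrZ exprMn ger0_norm ?invr_ge0// mulrA expr2; field.
by rewrite -!inner_normE dnormB dnormD; ring.
Qed.

End inner_inequalities.

Section adjoint_isometry.
Variables (R : realType) (H K : hilbertType R) (f : H -> K).
Hypothesis If : linear_isometry f.

(** The point g is the one where f comes closest to w; as f is an isometry,
    completeness of the source suffices for the minimum to be attained. *)
Lemma isometry_adjoint_at (w : K) : exists g, forall u, inner (f u) w = inner u g.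
Proof.
have [lf nf] := If.
have fZ a x y : f (a *: x + y) = a *: f x + f y by exact: lf.
have fD x y : f (x + y) = f x + f y by have := fZ 1 x y; rewrite !scale1r.
have f0 : f 0 = 0.
  by have := fD 0 0; rewrite addr0 -[LHS]addr0 => /addrI <-.
have fs a x : f (a *: x) = a *: f x by have := fZ a x 0; rewrite f0 !addr0.
pose N u : R := complex.Re (`|f u - w| ^+ 2).
have NE u : (N u)%:C%C = `|f u - w| ^+ 2 by rewrite /N RRe_real// ger0_real// exprn_ge0.
have N0 u : 0 <= N u by rewrite -ler0c NE exprn_ge0.
pose d := inf (range N).
have hN : has_inf (range N) by split; [exists (N 0), 0 | exists 0 => _ [u _ <-]].
have dN u : d <= N u by apply: ge_inf; [exact: hN.2 | exists u].
have e0 n : 0 < (2^-1 ^+ n.+1) ^+ 2 :> R by rewrite exprn_gt0// exprn_gt0// invr_gt0.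
(* The excess 4^-(n+1) over the infimum is chosen so that, by the parallelogram
   law, consecutive points of u are at distance at most 2^-n. *)
have /choice[u uP] : forall n, exists u, N u <= d + (2^-1 ^+ n.+1) ^+ 2.
  by move=> n; have [_ [u _ <-] /ltW] := inf_adherent (e0 n) hN; exists u.
have fB x y : f (x - y) = f x - f y.
  by rewrite addrC -scaleN1r fZ scaleN1r addrC.
have [n|g hg] := complete_fast_complete (y := u).
  rewrite -(@ler_pXn2r _ 2)// ?nnegrE ?exprn_ge0 ?invr_ge0//.
  rewrite -nf fB (_ : f _ - f _ = (f (u n.+1) - w) - (f (u n) - w)); last first.
    by rewrite opprB subrKA.
  rewrite parallelogram.
  rewrite (_ : 2^-1 *: _ = f (2^-1 *: (u n.+1 + u n)) - w); last first.
    have hw : 2^-1 *: (w + w) = w.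
      by rewrite scalerDr -scalerDl -div1r -splitr scale1r.
    by rewrite fs fD addrACA -opprD scalerBr hw.
  rewrite -!NE -half_powC.
  set m := _ *: _.
  have := uP n; have := uP n.+1; have := dN m.
  have : 2^-1 ^+ n.+1 = 2^-1 ^+ n / 2 :> R by rewrite exprSr.
  have : 2^-1 ^+ n.+2 = 2^-1 ^+ n / 4 :> R by rewrite !exprSr; field.
  move=> -> ->.
  rewrite (_ : _ - _ = (2 * N (u n.+1) + 2 * N (u n) - 4 * N m)%:C%C); last first.
    by rewrite rmorphB rmorphD !rmorphM !rmorph_nat.
  rewrite -rmorphXn /= lecR.
  have : 0 <= (2^-1 ^+ n)^+2 :> R by rewrite sqr_ge0.
  rewrite !exprMn.
  nra.
exists g => v.
have inner_small n : `|inner (f g - w) (f v)| <= 2 * 2^-1 ^+ n * (2 * `|v|).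
  rewrite (_ : f g - w = (f g - f (u n)) + (f (u n) - w)); last by rewrite subrKA.
  rewrite innerDl (le_trans (ler_normD _ _))// mulrA mulrAC mulr2n mulrDr mulr1.
  rewrite lerD//.
    rewrite -fB (isometry_inner If) (le_trans (norm_inner_le _ _))//.
    exact: ler_wpM2r.
  rewrite -(@ler_pXn2r _ 2)// ?nnegrE ?mulr_ge0 ?exprn_ge0 ?invr_ge0//.
  have := @almost_orthogonal _ _ (f (u n) - w) (f v) d%:C%C (((2^-1 ^+ n.+1) ^+ 2)%:C%C).
  rewrite inner_normE -NE -rmorphD lecR => /(_ (uP n)).
  move=> h; apply: le_trans (h _) _.
    move=> t; rewrite inner_normE (_ : _ + _ = f (t *: v + u n) - w).
      by rewrite -NE lecR.
    by rewrite fZ addrC addrA.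
  rewrite inner_normE nf exprMn ler_wpM2r ?exprn_ge0//.
  rewrite rmorphXn /= half_powC ler_pXn2r ?nnegrE ?mulr_ge0 ?exprn_ge0 ?invr_ge0//.
  rewrite exprS ler_wpM2r ?exprn_ge0 ?invr_ge0//.
  by rewrite (@le_trans _ _ 1) ?ler_wpDl// invf_le1 ?ler1n.
have inner0 : inner (f g - w) (f v) = 0.
  apply/normr0_eq0/le_anti; rewrite normr_ge0 andbT.
  apply/ler_addgt0Pr => e e_gt0; rewrite add0r.
  have v1 : 0 < 2 * `|v| + 1 by rewrite ltr_wpDl// mulr_ge0.
  have [n hn] := half_pow_small (divr_gt0 e_gt0 v1).
  apply: le_trans (inner_small n) _.
  apply: (le_trans (ler_wpM2r _ hn)); first by rewrite mulr_ge0.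
  by rewrite mulrAC ler_pdivrMr// ler_pM2l// lerDl.
rewrite -(isometry_inner If) [LHS]innerC [RHS]innerC; congr (_^*).
by apply/esym/eqP; rewrite -subr_eq0 -[X in _ == X]inner0 innerBl.
Qed.

Lemma isometry_adjoint : is_adjoint f (adjoint f).
Proof.
by have [g gP] := choice isometry_adjoint_at; rewrite (adjoint_unique (g := g)).
Qed.

Lemma inner_adjointl z v : inner (adjoint f z) v = inner z (f v).
Proof. by rewrite innerC -isometry_adjoint -innerC. Qed.

End adjoint_isometry.

(** * Completeness of L2 *)

Section L2_complete.
Context d (S : measurableType d) (R : realType) (mu : {measure set S -> \bar R}).
Local Notation normc := ComplexField.Normc.normc.

Lemma normc_sqr (z : R[i]) :
  normc z ^+ 2 = complex.Re z ^+ 2 + complex.Im z ^+ 2.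
Proof. by case: z => a b /=; rewrite sqr_sqrtr// addr_ge0 ?sqr_ge0. Qed.

Lemma normc_ge_Re (z : R[i]) : `|complex.Re z| <= normc z.
Proof.
rewrite -(@ler_pXn2r _ 2) ?nnegrE ?normc_ge0// normc_sqr real_normK ?num_real//.
by rewrite lerDl sqr_ge0.
Qed.

Lemma normc_ge_Im (z : R[i]) : `|complex.Im z| <= normc z.
Proof.
rewrite -(@ler_pXn2r _ 2) ?nnegrE ?normc_ge0// normc_sqr real_normK ?num_real//.
by rewrite lerDr sqr_ge0.
Qed.

Lemma Lnorm2_sqr (g : S -> R) :
  ('N[mu]_2%:E[EFin \o g] `^ 2 = \int[mu]_s ((g s) ^+ 2)%:E)%E.
Proof.
rewrite poweR_Lnorm//; apply: eq_integral => s _ /=.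
by rewrite powR_mulrn ?normr_ge0// real_normK// num_real.
Qed.

Lemma norm2_sqr (f : L2fun mu) :
  ((norm2 mu f ^+ 2)%:E = \int[mu]_s ((normc (f s)) ^+ 2)%:E)%E.
Proof.
by rewrite -Lnorm2_sqr -norm2E poweR_EFin powR_mulrn// fine_ge0 ?Lnorm_ge0.
Qed.

Lemma integral_sqr_le (g : S -> R) (B : R) : 0 <= B ->
  ('N[mu]_2%:E[EFin \o g] <= B%:E ->
   \int[mu]_s ((g s) ^+ 2)%:E <= (B ^+ 2)%:E)%E.
Proof.
move=> B0 gB; rewrite -Lnorm2_sqr.
have -> : ((B ^+ 2)%:E = B%:E `^ 2)%E by rewrite poweR_EFin powR_mulrn.
by rewrite gt0_ler_poweR// in_itv/= leey ?Lnorm_ge0// lee_fin B0.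
Qed.

Lemma finite_norm2_integral (f : S -> R[i]) :
  (\int[mu]_s ((normc (f s)) ^+ 2)%:E < +oo)%E ->
  finite_norm mu 2%:E (fun s => normc (f s)).
Proof.
move=> f2; rewrite /finite_norm unlock poweR_lty//.
rewrite [X in (X < _)%E](_ : _ = (\int[mu]_s ((normc (f s)) ^+ 2)%:E)%E)//.
apply: eq_integral => s _ /=.
by rewrite powR_mulrn ?normr_ge0// real_normK// num_real.
Qed.

Lemma cvg_summable_steps (v h : R^nat) (C : R) :
  (forall n, `|v n.+1 - v n| <= h n) ->
  (forall m, \sum_(0 <= k < m) h k <= C) -> cvgn v.
Proof.
move=> vh hC; have h0 n : 0 <= h n by apply: le_trans (vh n).
have cs : cvgn (series (telescope v)).
  apply: normed_cvg; apply: (@series_le_cvg _ _ h) => // [n|]; first exact: normr_ge0.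
  apply: nondecreasing_is_cvgn; last by exists C => _ [m _ <-]; exact: hC.
  by apply/nondecreasing_seqP => n; rewrite !seriesEnat/= big_nat_recr//= lerDl.
rewrite (_ : v = (cst (v 0) \+ series (telescope v))).
  by apply: is_cvgD => //; exact: is_cvg_cst.
by apply/funext => n; rewrite /= -eq_sum_telescope.
Qed.

Lemma cmeasurable_funB (f g : S -> R[i]) : cmeasurable_fun setT f ->
  cmeasurable_fun setT g -> cmeasurable_fun setT (fun s => f s - g s).
Proof.
move=> mf mg; have := cmeasurable_funD mf (cmeasurable_funZ (-1) mg).
by under [X in cmeasurable_fun _ X -> _]eq_fun do rewrite mulN1r.
Qed.

(** P n m is the sum of the moduli of the steps n, ..., n + m - 1 and L n the
    limit in m of its square, which has integral at most (2 * 2^-n)^2.  On the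
    set E where L 0 is finite, of full measure, the values f n s converge; L n
    dominates the squared distance from f n to the limit. *)
Section limit.
Variable f : nat -> S -> R[i].
Hypothesis mf : forall n, cmeasurable_fun setT (f n).
Hypothesis hf : forall n,
  ('N[mu]_2%:E[EFin \o (fun s => normc (f n.+1 s - f n s)%R)] <= (2^-1 ^+ n)%:E)%E.

Let h n s := normc (f n.+1 s - f n s).
Let P n m s : R := \sum_(0 <= k < m) h (n + k)%N s.
Let L n s := limn (fun m => ((P n m s) ^+ 2)%:E).
Let E := [set s | (L 0 s < +oo)%E].

Let mh n : measurable_fun setT (h n).
Proof. exact/cmeasurable_normc/cmeasurable_funB. Qed.

Let mP n m : measurable_fun setT (P n m).
Proof. by apply: measurable_sum => k; exact: mh. Qed.

Let h0 n s : 0 <= h n s. Proof. exact: normc_ge0. Qed.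

Let P0 n m s : 0 <= P n m s. Proof. by apply: sumr_ge0. Qed.

Let PS n m s : P n m.+1 s = P n m s + h (n + m)%N s.
Proof. by rewrite /P big_nat_recr. Qed.

Let P2_nd n s : {homo (fun m => ((P n m s) ^+ 2)%:E) : m k / (m <= k)%N >-> (m <= k)%E}.
Proof.
apply/nondecreasing_seqP => m; rewrite lee_fin ler_pXn2r ?nnegrE//.
by rewrite PS lerDl.
Qed.

Let P2_L n m s : (((P n m s) ^+ 2)%:E <= L n s)%E.
Proof.
rewrite /L (cvg_lim _ (ereal_nondecreasing_cvgn (@P2_nd n s)))//.
by apply: ereal_sup_ubound; exists m.
Qed.

Let mP2 n m : measurable_fun setT (fun s => ((P n m s) ^+ 2)%:E).
Proof. exact/measurable_EFinP/measurable_funX. Qed.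

Let mL n : measurable_fun setT (L n).
Proof.
apply: (emeasurable_fun_cvg (fun m s => ((P n m s) ^+ 2)%:E)) => // s _.
exact: (ereal_nondecreasing_is_cvgn (@P2_nd n s)).
Qed.

Let L0 n s : (0 <= L n s)%E.
Proof. by apply: le_trans (P2_L n 0 s); rewrite lee_fin sqr_ge0. Qed.

Let NP n m : ('N[mu]_2%:E[EFin \o P n m] <= (2 * 2^-1 ^+ n - 2 * 2^-1 ^+ (n + m))%:E)%E.
Proof.
elim: m => [|m IH].
  rewrite addn0 subrr (_ : EFin \o _ = cst 0%E) ?Lnorm0//.
  by apply/funext => s; rewrite /P /= big_nil.
rewrite (_ : P n m.+1 = (P n m \+ h (n + m))%R); last by apply/funext => s; exact: PS.
apply: (le_trans (minkowski_EFin _ _ _ _)) => //; first by rewrite ler1n.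
apply: (le_trans (leeD IH (hf _))); rewrite -EFinD lee_fin addnS exprSr.
by rewrite (_ : _ - _ + _ = 2 * 2^-1 ^+ n - 2 * (2^-1 ^+ (n + m) / 2))//; field.
Qed.

Let intL n : (\int[mu]_s L n s <= ((2 * 2^-1 ^+ n) ^+ 2)%:E)%E.
Proof.
rewrite monotone_convergence//; last first.
  by move=> m s _; rewrite lee_fin sqr_ge0.
apply: lime_le.
  apply: ereal_nondecreasing_is_cvgn => m k mk; apply: ge0_le_integral => //.
  - by move=> s _; rewrite lee_fin sqr_ge0.
  - by move=> s _; exact: P2_nd.
apply: nearW => m; apply: integral_sqr_le.
  by rewrite mulr_ge0// exprn_ge0// invr_ge0.
by apply: (le_trans (NP n m)); rewrite lee_fin gerBl mulr_ge0// exprn_ge0// invr_ge0.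
Qed.

Let aeE : {ae mu, forall s, E s}.
Proof.
have := @integrable_ae _ _ _ mu setT measurableT (L 0) _.
have iL : mu.-integrable setT (L 0).
  apply/integrableP; split => //.
  under eq_integral do rewrite gee0_abs//.
  by apply: le_lt_trans (intL 0) _; rewrite ltry.
move=> /(_ iL); apply: filterS => s /(_ I).
by rewrite ge0_fin_numE.
Qed.

Let mE : measurable E.
Proof.
by rewrite -[X in measurable X]setTI; exact: emeasurable_fun_infty_o.
Qed.

(* Multiplying by the indicator of E makes the sequence converge at every point,
   so that the limit is measurable. *)
Let ptwise s : exists z : R[i], 
  (complex.Re (f n s) * \1_E s) @[n --> \oo] --> complex.Re z /\
  (complex.Im (f n s) * \1_E s) @[n --> \oo] --> complex.Im z.
Proof.
rewrite indicE; have [sE|sE] := boolP (s \in E); last first.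
  exists 0; split; under eq_fun do rewrite mulr0; exact: cvg_cst.
have Lfin : L 0 s \is a fin_num by rewrite ge0_fin_numE//; rewrite inE in sE.
have PC m : \sum_(0 <= k < m) h k s <= fine (L 0 s) + 1.
  have : P 0 m s ^+ 2 <= fine (L 0 s) by rewrite -lee_fin fineK.
  have := P0 0 m s; rewrite /P; under eq_bigr do rewrite add0n.
  set x := \sum_(_ <= _ < _) _; nra.
have cr : cvgn (fun n => complex.Re (f n s)).
  apply: (cvg_summable_steps (h := fun n => h n s)) PC => n.
  by apply: le_trans (normc_ge_Re _); case: (f _ s) (f _ s) => [? ?] [? ?].
have ci : cvgn (fun n => complex.Im (f n s)).
  apply: (cvg_summable_steps (h := fun n => h n s)) PC => n.
  by apply: le_trans (normc_ge_Im _); case: (f _ s) (f _ s) => [? ?] [? ?].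
exists (Complex (limn (fun n => complex.Re (f n s)))
                (limn (fun n => complex.Im (f n s)))).
by split; under eq_fun do rewrite mulr1.
Qed.

(** For s in E the triangle inequality bounds |f (n + m) s - f n s| by
    P n m s, whatever m; the estimate follows on letting m tend to infinity. *)
Lemma fast_cauchy_limit : exists g : S -> R[i], cmeasurable_fun setT g /\
  forall n, (\int[mu]_s ((normc (g s - f n s)%R) ^+ 2)%:E <= ((2 * 2^-1 ^+ n) ^+ 2)%:E)%E.
Proof.
have [g gP] := choice ptwise.
have mg : cmeasurable_fun setT g.
  split.
  - apply: (measurable_fun_cvg (h := fun n s => complex.Re (f n s) * \1_E s)).
      by move=> n; apply: measurable_funM; [exact: (mf n).1|exact: measurable_indic].
    by move=> s _; exact: (gP s).1.
  - apply: (measurable_fun_cvg (h := fun n s => complex.Im (f n s) * \1_E s)).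
      by move=> n; apply: measurable_funM; [exact: (mf n).2|exact: measurable_indic].
    by move=> s _; exact: (gP s).2.
exists g; split=> // n; apply: le_trans (intL n).
apply: ae_ge0_le_integral => //.
- by move=> s _; rewrite lee_fin sqr_ge0.
- exact/measurable_EFinP/measurable_funX/cmeasurable_normc/cmeasurable_funB.
apply: filterS aeE => s sE _.
have fP m : normc (f (n + m)%N s - f n s) <= P n m s.
  elim: m => [|m IH]; first by rewrite addn0 subrr ComplexField.Normc.normc0.
  rewrite PS -(subrKA (f (n + m)%N s)) addrC (le_trans (le_normcD _ _))//.
  by rewrite lerD// addnS.
have [Lfin|] := ltP (L n s) +oo%E; last by rewrite leye_eq => /eqP ->; rewrite leey.
have {}Lfin : L n s \is a fin_num by rewrite ge0_fin_numE.
rewrite -(fineK Lfin) lee_fin.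
have [gr gi] := gP s; rewrite indicE mem_set// in gr gi.
have shift (u : R^nat) (l c : R) : u k * 1 @[k --> \oo] --> l ->
    (u (n + m)%N - c) ^+ 2 @[m --> \oo] --> (l - c) ^+ 2.
  under eq_fun do rewrite mulr1.
  move=> ul; have um : u (n + m)%N @[m --> \oo] --> l.
    rewrite (_ : (fun m => _) = (fun m => u (m + n)%N)).
      by move: ul; rewrite -(cvg_shiftn n).
    by apply/funext => m; rewrite addnC.
  under eq_fun do rewrite expr2; rewrite expr2.
  by apply: cvgM; apply: cvgB => //; exact: cvg_cst.
have cr := cvgD (shift _ _ (complex.Re (f n s)) gr) (shift _ _ (complex.Im (f n s)) gi).
have reB (z w : R[i]) : normc (z - w) ^+ 2 =
    (complex.Re z - complex.Re w) ^+ 2 + (complex.Im z - complex.Im w) ^+ 2.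
  by rewrite normc_sqr; case: z w => [? ?] [? ?].
rewrite reB.
apply: (cvgr_to_le (cr _)); apply: nearW => m.
rewrite [leLHS](_ : _ = normc (f (n + m)%N s - f n s) ^+ 2); last by rewrite reB.
rewrite -lee_fin fineK// (le_trans _ (P2_L n m s))//.
by rewrite lee_fin ler_pXn2r ?nnegrE ?normc_ge0.
Qed.
End limit.

Lemma L2_class_linear (a : R[i]) (f g : L2fun mu) :
  L2_class (a *: f + g) = a *: L2_class f + L2_class g.
Proof. by rewrite -L2_addE -L2_scaleE. Qed.

Lemma L2_classB (f g : L2fun mu) : L2_class (f - g) = L2_class f - L2_class g.
Proof. by rewrite -L2_addE -L2_oppE. Qed.

Lemma L2_class_norm (f : L2fun mu) : `|L2_class f| = (norm2 mu f)%:C%C.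
Proof. exact: L2_normE. Qed.

(** The theorem of Riesz and Fischer: the pointwise limit of representatives is
    also the limit in norm, and keeps the rate of convergence. *)
Lemma L2_fast_complete : fast_complete (L2 mu).
Proof.
move=> y hy; pose f n : L2fun mu := repr (y n).
have yE n : y n = L2_class (f n) by rewrite L2_funK.
have mf n : cmeasurable_fun setT (f n) by exact: (L2funP (f n)).1.
have [n|g [mg hg]] := fast_cauchy_limit mf.
  have := hy n; rewrite !yE -L2_classB L2_class_norm -half_powC lecR -lee_fin norm2E.
  exact.
have sqB n : (fun s => g s - f n s) \in L2fun_pred mu.
  rewrite inE; split; first exact: cmeasurable_funB.
  by apply: finite_norm2_integral; apply: le_lt_trans (hg n) _; rewrite ltry.
(* Only the differences g - f n are known to be square integrable; g is one of
   them plus a member of L2. *)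
exists (L2_class (L2Fun (sqB 0) + f 0)) => n.
rewrite yE -L2_classB (_ : _ - _ = L2Fun (sqB n)); last first.
  apply/val_inj/funext => s /=.
  rewrite -[LHS]/(g s - f 0 s + f 0 s - f n s).
  by rewrite subrK.
rewrite L2_class_norm -half_powC [leRHS](_ : _ = (2 * 2^-1 ^+ n)%:C%C); last first.
  by rewrite rmorphM rmorph_nat.
rewrite lecR.
rewrite -(@ler_pXn2r _ 2)// ?nnegrE ?mulr_ge0 ?exprn_ge0 ?invr_ge0 ?fine_ge0 ?Lnorm_ge0//.
by rewrite -lee_fin norm2_sqr; exact: hg.
Qed.
End L2_complete.

(** * The isometry of a square integrable map *)

Section complex_integral.
Context d (S : measurableType d) (R : realType) (mu : {measure set S -> \bar R}).

(** Bundling integrability with the value lets linearity be proved for both at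
    once; the equality alone is meaningless for non-integrable functions. *)
Definition has_cintegral (f : S -> R[i]) (z : R[i]) :=
  cintegrable mu f /\ cintegral mu f = z.

Lemma has_cintegral0 : has_cintegral (fun=> 0) 0.
Proof.
split; first by split; exact: integrable0.
by rewrite /cintegral /= /Rintegral integral0.
Qed.

Lemma has_cintegral_linear (a : R[i]) f g x y :
  has_cintegral f x -> has_cintegral g y ->
  has_cintegral (fun s => a * f s + g s) (a * x + y).
Proof.
move=> [[fr fi] <-] [[gr gi] <-].
have lin (r1 r2 : R) (h1 h2 h3 : S -> R) :
    mu.-integrable setT (EFin \o h1) -> mu.-integrable setT (EFin \o h2) ->
    mu.-integrable setT (EFin \o h3) ->
    mu.-integrable setT (EFin \o (fun s => r1 * h1 s + r2 * h2 s + h3 s)) /\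
    \int[mu]_s (r1 * h1 s + r2 * h2 s + h3 s) =
      r1 * \int[mu]_s h1 s + r2 * \int[mu]_s h2 s + \int[mu]_s h3 s.
  move=> i1 i2 i3.
  have j1 : mu.-integrable setT (EFin \o (fun s => r1 * h1 s)).
    exact: (integrableZl measurableT r1 i1).
  have j2 : mu.-integrable setT (EFin \o (fun s => r2 * h2 s)).
    exact: (integrableZl measurableT r2 i2).
  have j12 : mu.-integrable setT (EFin \o (fun s => r1 * h1 s + r2 * h2 s)).
    exact: (integrableD measurableT j1 j2).
  split; first exact: (integrableD measurableT j12 i3).
  by rewrite RintegralD// RintegralD// !RintegralZl.
have [Ir Er] := lin (complex.Re a) (- complex.Im a) _ _ _ fr fi gr.
have [Ii Ei] := lin (complex.Re a) (complex.Im a) _ _ _ fi fr gi.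
have ReE : (fun s => complex.Re (a * f s + g s)) =
    (fun s => complex.Re a * complex.Re (f s) + - complex.Im a * complex.Im (f s)
              + complex.Re (g s)).
  by apply/funext => s; case: (a) (f s) (g s) => [? ?] [? ?] [? ?] /=; rewrite mulNr.
have ImE : (fun s => complex.Im (a * f s + g s)) =
    (fun s => complex.Re a * complex.Im (f s) + complex.Im a * complex.Re (f s)
              + complex.Im (g s)).
  by apply/funext => s; case: (a) (f s) (g s) => [? ?] [? ?] [? ?] /=.
split; first by rewrite /cintegrable ReE ImE.
rewrite /cintegral ReE ImE Er Ei; case: (a) => p q /=.
by apply/eqP; rewrite eq_complex /= mulNr !eqxx.
Qed.

Lemma has_cintegral_sum I (r : seq I) (a : I -> R[i]) (f : I -> S -> R[i]) z :
  (forall i, has_cintegral (f i) (z i)) ->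
  has_cintegral (fun s => \sum_(i <- r) a i * f i s) (\sum_(i <- r) a i * z i).
Proof.
move=> hf; elim: r => [|i r IH].
  rewrite big_nil; under eq_fun do rewrite big_nil; exact: has_cintegral0.
rewrite big_cons; under eq_fun do rewrite big_cons.
exact: has_cintegral_linear.
Qed.

End complex_integral.

Section Phi_exists.
Context d (S : measurableType d) (R : realType) (mu : {measure set S -> \bar R}).
Variables (H : hilbertType R) (pi : S -> option (bounded_op H)).
Local Notation normc := ComplexField.Normc.normc.

Lemma cmeasurable_mcoef (u v : H) : measurable (op_dom pi) ->
  weakly_measurable pi -> cmeasurable_fun setT (mcoef pi u v).
Proof.
move=> mD /(_ u v)[mr mi]; split.
- move/(measurable_restrictT _ mD) : mr; congr (measurable_fun _ _).
  apply/funext => s; rewrite /patch /mcoef; case: ifPn => //.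
  by rewrite notin_setE /op_dom /=; case: (pi s).
- move/(measurable_restrictT _ mD) : mi; congr (measurable_fun _ _).
  apply/funext => s; rewrite /patch /mcoef; case: ifPn => //.
  by rewrite notin_setE /op_dom /=; case: (pi s).
Qed.

Lemma cmeasurable_mul_conj (f g : S -> R[i]) : cmeasurable_fun setT f ->
  cmeasurable_fun setT g -> cmeasurable_fun setT (fun s => f s * (g s)^*).
Proof.
move=> [fr fi] [gr gi]; split.
- rewrite (_ : (fun _ => _) = (fun s =>
    complex.Re (f s) * complex.Re (g s) + complex.Im (f s) * complex.Im (g s))).
    by apply: measurable_funD; apply: measurable_funM.
  by apply/funext => s; case: (f s) (g s) => [? ?] [? ?] /=; rewrite mulrN opprK.
- rewrite (_ : (fun _ => _) = (fun s =>
    complex.Im (f s) * complex.Re (g s) - complex.Re (f s) * complex.Im (g s))).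
    by apply: measurable_funB; apply: measurable_funM.
  by apply/funext => s; case: (f s) (g s) => [? ?] [? ?] /=; rewrite mulrN addrC.
Qed.

Lemma mcoef_mul_conj (u1 u2 v1 v2 : H) :
  (fun s => if pi s is Some A then inner (A u1) v1 * inner v2 (A u2) else 0) =
  (fun s => mcoef pi u1 v1 s * (mcoef pi u2 v2 s)^*).
Proof.
apply/funext => s; rewrite /mcoef; case: (pi s) => [A|]; last by rewrite mul0r.
by rewrite -innerC.
Qed.

Hypothesis SQpi : SQ mu pi.

(** The defining relations of SQ in the form used below: they prescribe the inner
    products in L2 of the coefficient functions. *)
Lemma SQ_mcoef (u1 u2 v1 v2 : H) :
  has_cintegral mu (fun s => mcoef pi u1 v1 s * (mcoef pi u2 v2 s)^*)
    (inner u1 u2 * inner v2 v1).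
Proof. by have [_ _ /(_ u1 u2 v1 v2)] := SQpi; rewrite mcoef_mul_conj. Qed.

Lemma Re_mul_conj (z : R[i]) : complex.Re (z * z^*) = normc z ^+ 2.
Proof.
rewrite -normCK normc_def -rmorphXn /= normc_sqr sqr_sqrtr//.
by rewrite addr_ge0 ?sqr_ge0.
Qed.

(** The case u1 = u2, v1 = v2 of the relations makes |mcoef|^2 integrable. *)
Lemma mcoef_L2fun (u v : H) : mcoef pi u v \in L2fun_pred mu.
Proof.
have [[mD _] wm _] := SQpi; rewrite inE; split; first exact: cmeasurable_mcoef.
apply: finite_norm2_integral; have [[ir _] _] := SQ_mcoef u u v v.
have /integrableP[_] := ir; apply: le_lt_trans.
rewrite le_eqVlt; apply/orP; left; apply/eqP; apply: eq_integral => s _ /=.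
by rewrite Re_mul_conj ger0_norm// sqr_ge0.
Qed.

Definition mcoef_L2 (u v : H) : L2fun mu := L2Fun (mcoef_L2fun u v).

Lemma norm_L2_class (f : L2fun mu) (z : R[i]) :
  has_cintegral mu (fun s => f s * (f s)^*) z -> `|L2_class f| ^+ 2 = z.
Proof.
move=> [_ <-]; rewrite L2_class_norm -rmorphXn /= /cintegral.
apply/eqP; rewrite eq_complex /=; apply/andP; split; apply/eqP.
  apply: EFin_inj; rewrite norm2_sqr /Rintegral.
  under [in RHS]eq_integral do rewrite Re_mul_conj.
  by rewrite -norm2_sqr fineK.
rewrite /Rintegral; under eq_integral do rewrite -normCK -add_Re2_Im2 /=.
by rewrite integral0.
Qed.

Variable T : hilbert_tensor H (conj_space H).

(** Both the coefficient functions in L2 and the elementary tensors have the Gram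
    matrix of entries <u, u'> <v', v>, so equal combinations have equal norms;
    the factor of the conjugate space turns <v, v'> into <v', v>. *)
Lemma Phi_exists : exists F, is_Phi pi (F : T -> L2 mu).
Proof.
have [||F [iF FE]] :=
  @tensor_extension _ _ _ T (L2 mu) (fun u v => L2_class (mcoef_L2 u v)).
- exact: L2_fast_complete.
- move=> s; apply/eqP; rewrite -(@eqrXn2 _ 2)//; apply/eqP.
  pose f (s : seq (R[i] * (H * H))) : L2fun mu :=
    \sum_(z <- s) z.1 *: mcoef_L2 z.2.1 z.2.2.
  have fE x : f s x = \sum_(z <- s) z.1 * mcoef pi z.2.1 z.2.2 x.
    rewrite /f; elim: (s) => [|z r IH]; first by rewrite !big_nil.
    by rewrite !big_cons -IH.
  have -> : \sum_(z <- s) z.1 *: L2_class (mcoef_L2 z.2.1 z.2.2) = L2_class (f s).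
    rewrite /f; elim: (s) => [|z r IH]; first by rewrite !big_nil.
    by rewrite !big_cons L2_class_linear -IH.
  apply: norm_L2_class; rewrite -inner_normE inner_span_tensor.
  have -> : (fun x => f s x * (f s x)^*) = (fun x => \sum_(z <- s) z.1 *
      \sum_(w <- s) (w.1)^* * (mcoef pi z.2.1 z.2.2 x * (mcoef pi w.2.1 w.2.2 x)^*)).
    apply/funext => x; rewrite !fE rmorph_sum /= mulr_suml; apply: eq_bigr => z _.
    rewrite -mulrA; congr (_ * _); rewrite mulr_sumr; apply: eq_bigr => w _.
    by rewrite rmorphM mulrCA.
  under eq_bigr => z _.
    under eq_bigr do rewrite -mulrA.
    rewrite -mulr_sumr; over.
  apply: has_cintegral_sum => z; apply: has_cintegral_sum => w.
  exact: SQ_mcoef.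
exists F; split=> // u v; rewrite FE; exact: L2_classK.
Qed.

Lemma PhiP : is_Phi pi (Phi mu T pi).
Proof. by have [F FP] := Phi_exists; rewrite (Phi_unique FP). Qed.

End Phi_exists.

(** * Change of variables *)

Section change_of_variables.
Context d1 d2 (S1 : measurableType d1) (S2 : measurableType d2) (R : realType).
Variables (mu1 : {measure set S1 -> \bar R}) (mu2 : {measure set S2 -> \bar R}).
Variable p : {mfun S2 >-> S1}.
Hypothesis p_mu2 : forall A, measurable A -> pushforward mu2 p A = mu1 A.

Lemma integral_comp_ae (f : S1 -> R) (g : S2 -> R) :
  measurable_fun setT f -> mu2.-integrable setT (EFin \o g) ->
  {ae mu2, forall s, f (p s) = g s} ->
  mu1.-integrable setT (EFin \o f) /\ \int[mu1]_s f s = \int[mu2]_s g s.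
Proof.
move=> mf ig fg.
have mf' : measurable_fun setT (EFin \o f) by exact/measurable_EFinP.
have mfp : measurable_fun setT (EFin \o f \o p) by exact: measurableT_comp.
have mg := measurable_int _ ig.
have ifp : mu2.-integrable setT (EFin \o f \o p).
  apply/integrableP; split=> //; have /integrableP[_] := ig.
  apply: le_lt_trans; rewrite le_eqVlt; apply/orP; left; apply/eqP.
  apply: ae_eq_integral => //; [exact: measurableT_comp|exact: measurableT_comp|].
  by apply: filterS fg => s /= fgs _; rewrite /= fgs.
have pE A : measurable A -> A `<=` setT -> mu1 A = pushforward mu2 p A.
  by move=> mA _; rewrite p_mu2.
split.
  apply/integrableP; split=> //.
  rewrite (eq_measure_integral (pushforward mu2 p) pE).
  by have /integrableP[] := @integrable_pushforward _ _ _ _ _ p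
    (measurable_funPT p) mu2 setT _ mf' ifp measurableT.
rewrite /Rintegral; congr fine.
rewrite (eq_measure_integral (pushforward mu2 p) pE) integral_pushforward// preimage_setT.
apply: ae_eq_integral => //.
by apply: filterS fg => s /= fgs _; rewrite /= fgs.
Qed.

Lemma has_cintegral_comp (f : S1 -> R[i]) (g : S2 -> R[i]) z :
  cmeasurable_fun setT f -> {ae mu2, forall s, f (p s) = g s} ->
  has_cintegral mu2 g z -> has_cintegral mu1 f z.
Proof.
move=> [mr mi] fg [[gr gi] <-].
have [ir Er] := integral_comp_ae mr gr (filterS (fun s e => congr1 _ e) fg).
have [ii Ei] := integral_comp_ae mi gi (filterS (fun s e => congr1 _ e) fg).
by split=> //; rewrite /cintegral Er Ei.
Qed.

Lemma L2_comp_isometry : linear_isometry (L2_comp p_mu2).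
Proof.
split.
- move=> a x y; rewrite -(L2_funK x) -(L2_funK y) -L2_class_linear !L2_compE.
  by rewrite -L2_class_linear; congr L2_class; exact/val_inj.
- move=> x; rewrite -(L2_funK x) L2_compE !L2_class_norm; congr (_%:C)%C.
  rewrite /norm2 -(Lnorm2_comp p_mu2)//; apply: cmeasurable_normc.
  exact: (L2funP _).1.
Qed.

End change_of_variables.

(** * Compression of square integrable maps *)

Theorem proposition2p10 (R : realType) (H1 H2 : hilbertType R)
  (d1 d2 : measure_display) (S1 : measurableType d1) (S2 : measurableType d2)
  (mu1 : {measure set S1 -> \bar R}) (mu2 : {measure set S2 -> \bar R})
  (pi1 : S1 -> option (bounded_op H1)) (pi2 : S2 -> option (bounded_op H2))
  (pi1_ae : ae_defined mu1 pi1) (pi1_wm : weakly_measurable pi1)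
  (pi2_ae : ae_defined mu2 pi2) (pi2_wm : weakly_measurable pi2)
  (p : {mfun S2 >-> S1})
  (p_mu2 : forall A : set S1, measurable A -> pushforward mu2 p A = mu1 A)
  (iota : H1 -> H2) (iota_isom : linear_isometry iota)
  (pi12 : {ae mu2, forall s, exists A1 A2,
     [/\ pi1 (p s) = Some A1, pi2 s = Some A2 &
         forall u, A1 u = adjoint iota (A2 (iota u))]}) :
  SQ mu2 pi2 ->
  SQ mu1 pi1 /\
  forall (T1 : hilbert_tensor H1 (conj_space H1))
         (T2 : hilbert_tensor H2 (conj_space H2)),
    [/\ linear_isometry (Phi mu1 T1 pi1),
        linear_isometry (Phi mu2 T2 pi2),
        linear_isometry (tensor_map T1 T2 iota iota),
        linear_isometry (L2_comp p_mu2) &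
        forall x : T1,
          L2_comp p_mu2 (Phi mu1 T1 pi1 x) =
          Phi mu2 T2 pi2 (tensor_map T1 T2 iota iota x)].
Proof.
move=> SQ2.
have coefE : {ae mu2, forall s, forall u v,
    mcoef pi1 u v (p s) = mcoef pi2 (iota u) (iota v) s}.
  apply: filterS pi12 => s [A1 [A2 [e1 e2 A12]]].
  by move=> u v; rewrite /mcoef e1 e2 A12 inner_adjointl.
have SQ1 : SQ mu1 pi1.
  split=> // u1 u2 v1 v2; rewrite mcoef_mul_conj.
  rewrite -!(isometry_inner iota_isom).
  apply: (has_cintegral_comp p_mu2 _ _ (SQ_mcoef SQ2 _ _ _ _)).
    by apply: cmeasurable_mul_conj; exact: cmeasurable_mcoef pi1_ae.1 _.
  by apply: filterS coefE => s E; rewrite !E.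
split=> // T1 T2.
have [iP1 P1] := PhiP SQ1 T1.
have [iP2 P2] := PhiP SQ2 T2.
have [iT TE] := tensor_map_exists T1 T2 iota_isom (conj_linear_isometry iota_isom).
have iL := L2_comp_isometry p_mu2.
split=> // x.
have comp_isometry (U V W : normedModType R[i]) (F : V -> W) (G : U -> V) :
    linear_isometry F -> linear_isometry G -> linear_isometry (F \o G).
  move=> [lF nF] [lG nG]; split=> [a u v|u] /=; last by rewrite nF nG.
  by rewrite lG lF.
have iLP := comp_isometry _ _ _ _ _ iL iP1.
have iPT := comp_isometry _ _ _ _ _ iP2 iT.
suff LPE : L2_comp p_mu2 \o Phi mu1 T1 pi1 =
    Phi mu2 T2 pi2 \o tensor_map T1 T2 iota iota by rewrite -[LHS]/((_ \o _) x) LPE.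
apply: (tensor_ext iLP.1 iPT.1).
- exact: linear_isometry_continuous.
- exact: linear_isometry_continuous.
move=> u v /=; rewrite TE; apply: L2_ext.
rewrite -[Phi mu1 T1 pi1 _]L2_funK L2_compE.
have P12 : {ae mu2, forall s, Phi mu1 T1 pi1 (tens T1 u v) (p s) =
    mcoef pi2 (iota u) (iota v) s}.
  by move: (ae_comp p_mu2 (P1 u v)) coefE; apply: filterS2 => s -> ->.
move: (L2_classK (L2fun_comp p_mu2 (repr (Phi mu1 T1 pi1 (tens T1 u v))))).
move: P12 (P2 (iota u) (iota v)).
by apply: filterS3 => s e1 e2 ->; rewrite e2 -e1.
Qed.
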